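(* Let $X$ be a dendroid that has at least one point $p$ such that $\{p\}$ is not a shore set of $X$, and let $A\in\mathcal C(X)$. Then $A\in\mathcal{CNB}(\mathcal F_1(X))$ (i.e. $A$ is a connected nonblocker of $X$) if and only if $A$ has empty interior in $X$ and $X\setminus A$ is arc-connected.
   Context: A continuum is a nonempty compact connected metric space. A continuum $X$ is unicoherent if $A\cap B$ is connected whenever $A,B$ are subcontinua with $A\cup B=X$; it is hereditarily unicoherent if each of its subcontinua is unicoherent. A dendroid is an arcwise connected hereditarily unicoherent continuum. $2^X$ is the space of all nonempty closed subsets of $X$ with the Hausdorff metric $\mathcal H$, and $\mathcal C(X)\subset 2^X$ is the subspace of connected ones. A set $A\in 2^X\setminus\{X\}$ is a shore set of $X$ if for each $\epsilon>0$ there is $B\in\mathcal C(X)$ with $\mathcal H(B,X)<\epsilon$ and $B\cap A=\emptyset$. An order arc is a continuous map $\alpha:[0,1]\to 2^X$ such that $\alpha(s)\subsetneq\alpha(t)$ whenever $0\le s<t\le 1$. A nonblocker of $X$ is a set $A\in 2^X\setminus\{X\}$ such that for every $x\in X\setminus A$ there is an order arc $\alpha:[0,1]\to \mathcal C(X)$ with $\alpha(0)=\{x\}$, $\alpha(1)=X$ and $\alpha(t)\cap A=\emptyset$ for all $t\in[0,1)$. $\mathcal{CNB}(\mathcal F_1(X))$ is the set of all connected nonblockers of $X$. A space is arc-connected if any two distinct points of it are the end points of an arc (homeomorphic copy of $[0,1]$) contained in it. *)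

(* Defs.v *)
From mathcomp Require Import all_boot all_order all_algebra.
From mathcomp Require Import all_classical all_reals all_analysis.

Set Implicit Arguments.
Unset Strict Implicit.
Unset Printing Implicit Defensive.

Import Order.TTheory GRing.Theory Num.Theory.
Import numFieldTopology.Exports.

Local Open Scope classical_set_scope.
Local Open Scope ring_scope.

Section Continua.
Context {R : realType} {X : metricType R}.
Implicit Types (A B C K S : set X) (x y : X).

(* A subset of X that is a continuum for the subspace metric; compactness and
   connectedness of a set do not depend on the ambient space. *)
Definition subcontinuum K := [/\ K !=set0, compact K & connected K].

Definition unicoherent K := forall A B,
  subcontinuum A -> subcontinuum B -> A `|` B = K -> connected (A `&` B).

Definition hereditarily_unicoherent S :=
  forall K, subcontinuum K -> K `<=` S -> unicoherent K.

(* C is the image of a homeomorphism f from [0, 1] onto C, with inverse g, such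
   that f 0 = x and f 1 = y; outside [0, 1] and C the values of f and g are
   irrelevant. *)
Definition arc_between x y C := exists (f : R -> X) (g : X -> R),
  [/\ {within `[0, 1], continuous f}, {within C, continuous g},
      set_bij `[0, 1] C f, {in `[0, 1], cancel f g} & f 0 = x /\ f 1 = y].

Definition arc_connected S := forall x y,
  S x -> S y -> x <> y -> exists2 C, arc_between x y C & C `<=` S.

(* The hyperspaces 2^X and C(X). *)
Definition closed_hyperspace : set (set X) := [set A | A !=set0 /\ closed A].

Definition connected_hyperspace : set (set X) :=
  [set A | closed_hyperspace A /\ connected A].

Definition nbhd (r : R) A : set X := \bigcup_(a in A) ball a r.

(* For nonempty bounded A and B the infimum is over a nonempty set; otherwise
   the value may be junk (inf set0 = 0). *)
Definition hausdorff_dist A B : R :=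
  inf [set r | [/\ 0 < r, A `<=` nbhd r B & B `<=` nbhd r A]].

Definition shore_set A :=
  [/\ closed_hyperspace A, A <> setT &
      forall e : R, 0 < e -> exists B,
        [/\ connected_hyperspace B, hausdorff_dist B setT < e &
            B `&` A = set0]].

(* A map [0, 1] -> 2^X is encoded as a function on R whose values outside
   [0, 1] are irrelevant; the second clause is its continuity for the Hausdorff
   metric. *)
Definition order_arc (alpha : R -> set X) :=
  [/\ forall t : R, t \in `[0, 1] -> closed_hyperspace (alpha t),
      forall t : R, t \in `[0, 1] -> forall e : R, 0 < e ->
        \forall s \near within `[0, 1] (nbhs t),
          hausdorff_dist (alpha t) (alpha s) < e &
      forall s t, 0 <= s -> s < t -> t <= 1 -> alpha s `<` alpha t].

Definition nonblocker A :=
  [/\ closed_hyperspace A, A <> setT &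
      forall x, ~ A x -> exists alpha : R -> set X,
        [/\ order_arc alpha,
            forall t : R, t \in `[0, 1] -> connected_hyperspace (alpha t),
            alpha 0 = [set x], alpha 1 = setT &
            forall t : R, t \in `[0, 1[ -> alpha t `&` A = set0]].

(* CNB(F_1(X)) *)
Definition connected_nonblockers : set (set X) :=
  [set A | nonblocker A /\ connected A].

End Continua.

Definition continuum {R : realType} (X : metricType R) :=
  subcontinuum [set: X].

Definition dendroid {R : realType} (X : metricType R) :=
  [/\ continuum X, arc_connected [set: X] &
      hereditarily_unicoherent [set: X]].

(* Main.v *)
(* Nonblocker implies the right-hand side: order arcs ending at X provide, for
   every x outside A, subcontinua through x that miss A and are arbitrarily
   Hausdorff-close to X, so A has no interior. If {p} is not a shore set, such
   subcontinua through x and through y both contain p once they are close enough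
   to X; their union is a subcontinuum missing A and, by hereditary
   unicoherence, contains the arc from x to y.

   Conversely, an order arc from {x} to X is grown by following arcs. Given a
   subcontinuum K through x missing A, an arc in X \ A from x to a point outside
   K is attached to K progressively, from its last point in K on. Choosing the
   successive targets in the members of a countable basis gives an increasing
   chain whose union is dense, because A has empty interior; parametrizing the
   concatenation by [0, 1[ and adding X at 1 yields the order arc. *)
From HB Require Import structures.
Require Import Defs.
From mathcomp Require Import all_boot all_order all_algebra.
From mathcomp Require Import all_classical all_reals all_analysis.
From mathcomp Require Import lra.
Import Order.TTheory GRing.Theory Num.Theory.
Import numFieldTopology.Exports.
Local Open Scope classical_set_scope.
Local Open Scope ring_scope.

Section Continua.
Context {R : realType} {X : metricType R}.
Implicit Types (A B C K : set X) (x y : X) (e : R) (P : R -> set X).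

(** * Closeness in the Hausdorff metric *)

Definition hclose e A B := A `<=` nbhd e B /\ B `<=` nbhd e A.

Lemma nbhd_refl e A : 0 < e -> A `<=` nbhd e A.
Proof. by move=> e0 a Aa; exists a => //; exact: ballxx. Qed.

Lemma nbhd_sub e e' A B : e <= e' -> A `<=` B -> nbhd e A `<=` nbhd e' B.
Proof. by move=> ee' AB y [a /AB Ba ay]; exists a => //; exact: le_ball ay. Qed.

Lemma hclose_refl e A : 0 < e -> hclose e A A.
Proof. by move=> e0; split; exact: nbhd_refl. Qed.

Lemma hclose_sub e A B : 0 < e -> A `<=` B -> B `<=` nbhd e A -> hclose e A B.
Proof.
by move=> e0 AB BA; split=> //; apply: subset_trans AB (nbhd_refl _ _ e0).
Qed.

Lemma hcloseC e A B : hclose e A B -> hclose e B A.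
Proof. by case. Qed.

Lemma hausdorff_distC A B : hausdorff_dist A B = hausdorff_dist B A.
Proof.
by rewrite /hausdorff_dist; congr inf; apply/seteqP; split=> r [].
Qed.

Lemma hausdorff_dist_le e A B : 0 < e -> hclose e A B -> hausdorff_dist A B <= e.
Proof. by move=> e0 [AB BA]; apply: ge_inf => //; exists 0 => r [/ltW]. Qed.

Lemma compact_ball_bounded : compact [set: X] ->
  exists2 r : R, 0 < r & forall x y, ball x r y.
Proof.
move=> /compact_near_coveringP cX.
have [x0|X0] := pselect (exists x0 : X, True); last first.
  by exists 1 => // x; exfalso; apply: X0; exists x.
case: x0 => x0 _.
have [|N _ bN] := cX nat \oo (fun n y => ball x0 n.+1%:R y) _.
  move=> x _; near=> y n.
  have -> : n.+1%:R = n%:R + 1 :> R by rewrite -natr1.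
  apply: (@ball_triangle _ _ x); last by near: y; exact: nbhsx_ballx.
  rewrite ballEmdist/=; near: n; exact: nbhs_infty_gtr.
exists (N.+1%:R + N.+1%:R) => [|x y]; first by rewrite addr_gt0.
apply: (@ball_triangle _ _ x0); last exact: (bN N (leqnn N)).
by apply: ball_sym; exact: (bN N (leqnn N)).
Unshelve. all: by end_near. Qed.

(** Boundedness of the compact space and nonemptiness of both sets supply an admissible radius, so
    the infimum is not the default value of [inf set0]. *)
Lemma hausdorff_dist_lt e A B : compact [set: X] -> A !=set0 -> B !=set0 ->
  hausdorff_dist A B < e -> hclose e A B.
Proof.
move=> /compact_ball_bounded[r r0 br] [a Aa] [b Bb] /inf_lt[].
  by exists r; split=> // y _; [exists b|exists a].
move=> d [d0 AB BA] de; split.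
  by apply: subset_trans AB _; apply: nbhd_sub => //; exact: ltW.
by apply: subset_trans BA _; apply: nbhd_sub => //; exact: ltW.
Qed.

(** * Arcs and subcontinua *)

Lemma arc_between_subcontinuum x y C : arc_between x y C ->
  [/\ subcontinuum C, C x & C y].
Proof.
move=> [f [g [fc gc [fC _ Cf] fK [<- <-]]]].
have C0 : C (f 0) by apply: fC; rewrite /= in_itv/= lexx ler01.
split=> //; last by apply: fC; rewrite /= in_itv/= lexx ler01.
have -> : C = f @` `[0, 1] by apply/seteqP; split=> // z [t /fC Cft <-].
split.
- by exists (f 0); exists 0 => //=; rewrite in_itv/= lexx ler01.
- by apply: continuous_compact fc _; exact: segment_compact.
- by apply: connected_continuous_connected => //; exact: segment_connected.
Qed.

Lemma subcontinuumU K C : K `&` C !=set0 -> subcontinuum K -> subcontinuum C ->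
  subcontinuum (K `|` C).
Proof.
move=> KC [[x Kx] cK ctK] [_ cC ctC]; split; first by exists x; left.
  exact: compactU.
exact: connectedU.
Qed.

(* In a hereditarily unicoherent continuum, [K `&` C] is connected and contains
   the end points of the arc [C], so it is [C]. *)
Lemma arc_between_sub x y C K : hereditarily_unicoherent [set: X] ->
  subcontinuum K -> K x -> K y -> arc_between x y C -> C `<=` K.
Proof.
move=> hu sK Kx Ky xyC; have [sC Cx Cy] := arc_between_subcontinuum _ _ _ xyC.
have KC0 : K `&` C !=set0 by exists x.
have ctKC : connected (K `&` C).
  by apply: (hu (K `|` C)) => //; exact: subcontinuumU.
case: xyC => f [g [fc gc [fC _ Cf] fK [f0 f1]]].
have i0 : 0 \in (`[0, 1] : interval R) by rewrite in_itv/= lexx ler01.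
have i1 : 1 \in (`[0, 1] : interval R) by rewrite in_itv/= lexx ler01.
(* Seen in the parameter line, the connected set becomes an interval; it contains 0 and 1, hence
   every parameter of the arc. *)
have gi : is_interval (g @` (K `&` C)).
  apply/connected_intervalP; apply: connected_continuous_connected => //.
  by apply: continuous_subspaceW gc => z [].
move=> z /Cf[t t01 <-].
have [w [Kw Cw]] : (g @` (K `&` C)) t.
  apply: (gi 0 1); last by move: t01; rewrite /= in_itv.
    by exists x => //; rewrite -f0 fK.
  by exists y => //; rewrite -f1 fK.
by case/Cf : Cw Kw => u u01 <-; rewrite fK// => ? <-.
Qed.

(** * Nonblockers: interior and complement *)

(** Stop the order arc just before 1: continuity at 1 gives closeness to [X], and every value before
    1 misses [A]. *)
Lemma nonblocker_approx A x e : compact [set: X] -> nonblocker A -> ~ A x ->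
  0 < e -> exists K, [/\ subcontinuum K, K x, K `&` A = set0 &
    hausdorff_dist K [set: X] < e].
Proof.
move=> cX [_ _ nb] /nb[alpha [[acl acont ainc] acon a0 a1 aA]] e0.
have i1 : 1 \in (`[0, 1] : interval R) by rewrite in_itv/= lexx ler01.
have /nbhs_ballP[d /= d0 hd] := acont 1 i1 _ e0.
have [s s0 [s1 sd]] : exists2 s : R, 0 < s & s < 1 /\ `|1 - s| < d.
  (* The bound [1 / 2] keeps [s] positive, so that the strict inclusion of [alpha 0] in [alpha s]
     puts [x] in [alpha s]. *)
  clear -d0; exists (1 - Num.min (d / 2) (1 / 2)).
    by rewrite subr_gt0 gt_min; apply/orP; right; lra.
  split; first by rewrite gtrBl lt_min; apply/andP; split; lra.
  by rewrite subKr ger0_norm ?le_min ?gt_min; [lra|apply/andP; split; lra].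
have i01 : s \in (`[0, 1] : interval R) by rewrite in_itv/= !ltW.
have [[as0 cls] cts] := acon _ i01.
exists (alpha s); split.
- by split=> //; exact: subclosed_compact cX _.
- by have [+ _] := ainc 0 s (lexx _) s0 (ltW s1); rewrite a0; apply.
- by apply: aA; rewrite in_itv/= s1 ltW.
- by rewrite hausdorff_distC -a1; exact: hd.
Qed.

Lemma subcontinuum_hyperspace K : subcontinuum K -> connected_hyperspace K.
Proof.
by move=> [K0 cK ctK]; split=> //; split=> //; apply: compact_closed => //;
  exact: metric_hausdorff.
Qed.

(** An [e]-ball inside [A] would meet every set that is [e]-close to [X], even the approximants that
    miss [A]. *)
Lemma nonblocker_interior0 A : compact [set: X] -> nonblocker A ->
  interior A = set0.
Proof.
move=> cX nbA; have [_ AT _] := nbA.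
have [x Ax] : exists x, ~ A x.
  by apply/existsNP => h; apply: AT; apply/seteqP; split=> // z _; exact: h.
apply/seteqP; split=> // y /nbhs_ballP[e /= e0 yeA].
have [K [[K0 _ _] Kx KA Ke]] := nonblocker_approx _ _ _ cX nbA Ax e0.
have [_ /(_ y I)] := hausdorff_dist_lt _ _ _ cX K0 (ex_intro _ x I) Ke.
move=> [a Ka /ball_sym/yeA Aa].
by have : (K `&` A) a by []; rewrite KA.
Qed.

Lemma nonblocker_arc_connectedC A : dendroid X ->
  (exists p : X, ~ shore_set [set p]) -> nonblocker A -> arc_connected (~` A).
Proof.
move=> [[_ cX _] acX hu] [p np] nbA x y Ax Ay xy.
(* The singleton of [p] is closed and, as [x] and [y] differ, is not [X]; so it is the approximation
   clause of [shore_set] that fails, at some [e]. *)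
have [e e0 he] : exists2 e : R, 0 < e & forall B, connected_hyperspace B ->
    hausdorff_dist B [set: X] < e -> B p.
  apply: contrapT => he; apply: np; split.
  - by split; [exists p|apply: accessible_closed_set1; apply: hausdorff_accessible;
      exact: metric_hausdorff].
  - move=> pT; apply: xy.
    by have [-> ->] : [set p] x /\ [set p] y by rewrite pT.
  - move=> e e0; apply: contrapT => hB; apply: he; exists e => // B cB Be.
    apply: contrapT => Bp; apply: hB; exists B; split=> //.
    by apply/seteqP; split=> // z [+ zp]; rewrite zp.
have [K [sK Kx KA Ke]] := nonblocker_approx _ _ _ cX nbA Ax e0.
have [L [sL Ly LA Le]] := nonblocker_approx _ _ _ cX nbA Ay e0.
have [C xyC _] := acX x y I I xy; exists C => //.
have sKL : subcontinuum (K `|` L).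
  apply: subcontinuumU => //.
  by exists p; split; apply: he => //; exact: subcontinuum_hyperspace.
have CKL : C `<=` K `|` L.
  by apply: arc_between_sub xyC => //; [left|right].
move=> z /CKL[Kz|Lz] Az.
  by have : (K `&` A) z by []; rewrite KA.
by have : (L `&` A) z by []; rewrite LA.
Qed.

(** * Growth of a subcontinuum along an arc *)

(** Stated with [hclose] to keep infima out of the construction until [order_arc_completion]. The
    domain varies: [[0, 1]] for one growth, the nonnegative reals for a concatenation. *)
Definition hcontinuous (D : set R) P := forall t, D t -> forall e, 0 < e ->
  exists2 d : R, 0 < d &
    forall s, D s -> `|t - s| < d -> hclose e (P t) (P s).

Definition hincreasing (D : set R) P :=
  forall s t, D s -> D t -> s < t -> P s `<` P t.

Lemma within_continuous_ball (D : set R) (f : R -> X) :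
  {within D, continuous f} -> forall t, D t -> forall e, 0 < e ->
  exists2 d : R, 0 < d & forall s, D s -> `|t - s| < d -> ball (f t) e (f s).
Proof.
move=> /subspace_continuousP fc t Dt e e0.
have /nbhs_ballP[d /= d0 hd] := fc t Dt _ (nbhsx_ballx (f t) e e0).
by exists d => // s Ds ts; exact: hd.
Qed.

(* Only the part of the arc after its last point [f c] in [K] is added to [K]:
   this makes the growth strict. *)
Lemma arc_growth x y C K : subcontinuum K -> K x -> ~ K y ->
  arc_between x y C -> exists G : R -> set X,
  [/\ G 0 = K, G 1 y,
      forall u, `[0, 1]%classic u -> [/\ subcontinuum (G u), G u x &
        G u `<=` K `|` C],
      hcontinuous `[0, 1] G & hincreasing `[0, 1] G].
Proof.
move=> [K0 cK ctK] Kx Ky xyC; have [[_ cC _] Cx Cy] := arc_between_subcontinuum _ _ _ xyC.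
case: xyC => f [g [fc gc [fC _ Cf] fK [f0 f1]]].
have i0 : 0 \in (`[0, 1] : interval R) by rewrite in_itv/= lexx ler01.
have i1 : 1 \in (`[0, 1] : interval R) by rewrite in_itv/= lexx ler01.
(* [J] collects the parameters at which the arc is in [K]. As a continuous image of a compact set it
   is compact, so its supremum is attained: this is the last passage in [K]. *)
pose J := g @` (K `&` C).
have J0 : J 0 by exists x => //; rewrite -f0 fK.
have cJ : compact J.
  apply: continuous_compact; first by apply: continuous_subspaceW gc => z [].
  apply: compact_closedI => //; apply: compact_closed => //.
  exact: metric_hausdorff.
have Jf t : J t -> 0 <= t <= 1 /\ K (f t).
  move=> [z [Kz /Cf[u u01 uz]] <-]; rewrite -uz fK//; split; last by rewrite uz.
  by move: u01; rewrite /= in_itv.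
have ubJ : has_ubound J by exists 1 => t /Jf[/andP[]].
have Jc : J (sup J).
  apply: (compact_closed (@Rhausdorff R) cJ); apply: closure_sup => //.
  by exists 0.
have [/andP[c0 c1] Kc] := Jf _ Jc.
have maxc t : 0 <= t <= 1 -> K (f t) -> t <= sup J.
  move=> t01 Kt; apply: ub_le_sup => //; exists (f t); last by rewrite fK.
  by split=> //; apply: fC.
move: (sup J) c0 c1 Kc maxc => c c0 c1 Kc maxc {J J0 cJ Jf ubJ Jc}.
have {}c1 : c < 1.
  rewrite lt_neqAle c1 andbT; apply/eqP => c1'.
  by apply: Ky; rewrite -f1 -c1'.
(* [v] maps [[0, 1]] affinely onto [[c, 1]]: growth starts at [f c], already in [K], and ends at
   [f 1 = y]. *)
pose v u := c + u * (1 - c).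
have v_itv u : `[0, 1]%classic u -> c <= v u <= 1.
  rewrite /= in_itv/= /v => /andP[u0 u1]; rewrite lerDl mulr_ge0 ?subr_ge0 ?(ltW c1)//=.
  by rewrite -lerBrDl ler_piMl // subr_ge0 ltW.
have v_inc s t : s < t -> v s < v t.
  by move=> st; rewrite /v ltrD2l ltr_pM2r// subr_gt0.
pose G u := K `|` f @` `[c, v u].
have sub01 u : `[0, 1]%classic u -> `[c, v u] `<=` `[0, 1].
  move=> /v_itv/andP[_ vu1] w /=; rewrite !in_itv/= => /andP[cw wv].
  by rewrite (le_trans c0 cw) (le_trans wv vu1).
exists G; split.
- rewrite /G /v mul0r addr0; apply/seteqP; split=> [z [//|[t]]|z]; last by left.
  by rewrite /= in_itv/= => /le_anti <- <-.
- right; exists 1; rewrite //= in_itv/= /v mul1r; lra.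
- move=> u u01; have /andP[cv v1] := v_itv u u01.
  have fcu : {within `[c, v u], continuous f}.
    by apply: continuous_subspaceW fc; exact: sub01.
  have Gc : (f @` `[c, v u]) (f c) by exists c => //=; rewrite in_itv/= lexx.
  split; last 2 first.
  + by left.
  + by apply: setUS => _ [t /(sub01 _ u01) t01 <-]; exact: fC.
  apply: subcontinuumU => //; first by exists (f c).
  split; first by exists (f c).
  + by apply: continuous_compact fcu _; exact: segment_compact.
  + by apply: connected_continuous_connected => //; exact: segment_connected.
- move=> u u01 e e0; have e20 : 0 < e / 2 by rewrite divr_gt0.
  have /andP[cv v1] := v_itv u u01.
  have vu01 : `[0, 1]%classic (v u) by rewrite /= in_itv/= v1 (le_trans c0).
  have [d d0 hd] := within_continuous_ball _ _ fc (v u) vu01 _ e20.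
  exists d => // s s01 us.
  have /andP[cvs vs1] := v_itv s s01.
  have vus : `|v u - v s| < d.
    apply: le_lt_trans us; rewrite /v [_ - _](_ : _ = (u - s) * (1 - c)); last by lra.
    by rewrite normrM [`|1 - c|]ger0_norm ?ler_piMr//; lra.
  (* Continuity at the single point [v u] compares two nearby parameters, both images being within
     [e / 2] of [f (v u)]. *)
  have hd2 w w' : c <= w <= 1 -> c <= w' <= 1 -> `|v u - w| < d ->
      `|v u - w'| < d -> ball (f w) e (f w').
    move=> /andP[cw w1] /andP[cw' w'1] uw uw'; rewrite (splitr e).
    apply: (@ball_triangle _ _ (f (v u))).
      by apply: ball_sym; apply: hd => //; rewrite /= in_itv/= w1 (le_trans c0).
    by apply: hd => //; rewrite /= in_itv/= w'1 (le_trans c0).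
  have mono a b : a <= b -> K `|` f @` `[c, a] `<=` K `|` f @` `[c, b].
    move=> ab; apply: setUS; apply: image_subset => w /=; rewrite !in_itv/=.
    by move=> /andP[-> wa]; exact: le_trans wa ab.
  (* The points gained from [a] to [b] are all within [e] of [f a], which belongs to the smaller
     set. *)
  have near_mono a b : c <= a -> a <= b -> b <= 1 -> `|v u - a| < d -> `|v u - b| < d ->
      hclose e (K `|` f @` `[c, a]) (K `|` f @` `[c, b]).
    move=> ca ab b1 ua ub; apply: hclose_sub => //; first exact: mono.
    move=> z [Kz|[w]]; first by apply: nbhd_refl => //; left.
    rewrite /= in_itv/= => /andP[cw wb] <-.
    have [wa|aw] := leP w a.
      by apply: nbhd_refl => //; right; exists w => //=; rewrite in_itv/= cw.
    exists (f a); first by right; exists a => //=; rewrite in_itv/= ca lexx.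
    apply: hd2 => //; rewrite ?ca ?cw/= ?(le_trans ab b1)// ?(le_trans wb b1)//.
    move: ua ub; rewrite !ltr_norml; lra.
  have [vv|/ltW vv] := leP (v u) (v s).
    by apply: near_mono => //; rewrite subrr normr0.
  by apply: hcloseC; apply: near_mono => //; rewrite subrr normr0.
- move=> s t s01 t01 st; split.
    apply: setUS; apply: image_subset => w /=; rewrite !in_itv/=.
    by move=> /andP[-> wa]; apply: le_trans wa (ltW (v_inc _ _ st)).
  have /andP[cvs vs1] := v_itv s s01.
  have /andP[cvt vt1] := v_itv t t01.
  have vst := v_inc _ _ st.
  have it : v t \in (`[0, 1] : interval R) by rewrite in_itv/= vt1 (le_trans c0).
  (* The new point is [f (v t)]: it is outside [K] because [c] is the last passage, and outside the
     earlier piece because [f] is injective. *)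
  move=> /(_ (f (v t)))[|Kvt|[w wvs fwt]].
  + by right; exists (v t); rewrite //= in_itv/= cvt lexx.
  + have : v t <= c by apply: maxc => //; rewrite vt1 (le_trans c0).
    by rewrite leNgt (le_lt_trans cvs vst).
  + have wE : w = v t.
      by rewrite -[w]fK ?fwt ?fK//; exact: sub01 s01 _ wvs.
    by move: wvs; rewrite wE /= in_itv/= [v t <= _]leNgt vst andbF.
Qed.

(** * Reaching the members of a countable pi-base *)

Lemma compact_countable_pibase x : compact [set: X] -> exists U : nat -> set X,
  [/\ forall n, open (U n), forall n, U n !=set0 &
      forall y e, 0 < e -> exists n, U n `<=` ball y e].
Proof.
move=> cX; pose Xp : pseudoPMetricType R := HB.pack X (isPointed.Build X x).
have [B cB [Bo Bb]] := @compact_second_countable R Xp cX.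
have /countable_injP[h hinj] := cB.
pose W n V := [/\ B V, V !=set0 & h V = n].
(* Since [h] is injective on the basis, at most one nonempty member has code [n]; a code without
   such a member is given the whole space. *)
have /choice[U hU] n : exists V : set X, (open V /\ V !=set0) /\
    forall V', W n V' -> V' = V.
  have [[V WV]|nV] := pselect (exists V, W n V); last first.
    exists setT; split; first by split; [exact: openT|exists x].
    by move=> V WV; exfalso; apply: nV; exists V.
  exists V; have [BV V0 hV] := WV; split; first by split=> //; exact: Bo.
  by move=> V' [BV' _ hV']; apply: hinj; rewrite ?inE// hV.
exists U; split=> [n|n|y e e0]; try by have [[]] := hU n.
have [V [BV Vy] Vye] := Bb y _ (nbhsx_ballx (y : X) e e0).
exists (h V); have [_ /(_ V) <- //] := hU (h V).
by split=> //; exists y.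
Qed.

Definition growth A x K := [/\ subcontinuum K, K x & K `&` A = set0].

Lemma growth_step A x K U : A !=set0 -> interior A = set0 ->
  arc_connected (~` A) -> growth A x K -> open U -> U !=set0 ->
  exists G : R -> set X,
  [/\ G 0 = K, G 1 `&` U !=set0,
      forall u, `[0, 1]%classic u -> growth A x (G u),
      hcontinuous `[0, 1] G & hincreasing `[0, 1] G].
Proof.
move=> [a Aa] A0 acA [sK Kx KA] oU [w Uw].
have KnA z : K z -> ~ A z by move=> Kz Az; have : (K `&` A) z by []; rewrite KA.
have clK : closed K.
  by apply: compact_closed; [exact: metric_hausdorff|case: sK].
have dense V : open V -> V !=set0 -> exists2 z, V z & ~ A z.
  move=> oV [v Vv]; apply: contrapT => nV.
  have : interior A v; last by rewrite A0.
  apply: (@filterS _ _ _ V); last exact: open_nbhs_nbhs.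
  by move=> z Vz; apply: contrapT => Az; apply: nV; exists z.
(* The target must be outside [K] for the growth to be strict. If the chosen point of [U] is already
   in [K], any point outside [K] and [A] serves; one exists because the complement of [K] is open
   and contains [A], hence is nonempty. *)
have [y [Ay Ky Uy]] : exists y, [/\ ~ A y, ~ K y & K `&` U !=set0 \/ U y].
  have [z Uz Az] := dense U oU (ex_intro _ w Uw).
  have [Kz|Kz] := pselect (K z); last by exists z; split=> //; right.
  have [||y Ky Ay] := dense (~` K); first exact: closed_openC.
    by exists a => Ka; exact: KnA Aa.
  by exists y; split=> //; left; exists z.
have xy : x <> y by move=> xy; apply: Ky; rewrite -xy.
have [C xyC CA] := acA _ _ (KnA _ Kx) Ay xy.
have [G [G0 G1 Gg Gc Gi]] := arc_growth _ _ _ _ sK Kx Ky xyC.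
exists G; split=> //.
- case: Uy => [[z [Kz Uz]]|Uy]; last by exists y.
  exists z; split=> //; have := Gi 0 1.
  by rewrite /= !in_itv/= !lexx !ler01 ltr01 G0 => /(_ isT isT isT)[+ _]; apply.
- move=> u /Gg[sG Gx GKC]; split=> //; apply/seteqP; split=> // z [/GKC[Kz|Cz] Az].
    exact: KnA Az.
  exact: CA Az.
Qed.

(** * Concatenation of a chain of growths *)

Section Concatenation.
Variable G : nat -> R -> set X.
Hypothesis G_chain : forall n, G n 1 = G n.+1 0.
Hypothesis G_inc : forall n, hincreasing `[0, 1] (G n).

(** The integer part selects the piece and the fractional part its parameter. A positive integer is
    read as the start of a piece, which [G_chain] identifies with the end of the preceding one. *)
Definition concatenation (t : R) : set X :=
  G (Num.truncn t) (t - (Num.truncn t)%:R).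

Let mem1 : `[0, 1]%classic (1 : R).
Proof. by rewrite /= in_itv/= lexx ler01. Qed.

Lemma frac_itv (t : R) : 0 <= t ->
  `[0, 1]%classic (t - (Num.truncn t)%:R) /\ t - (Num.truncn t)%:R < 1.
Proof.
move=> /Num.Theory.truncn_itv/andP[nt tn]; move: tn; rewrite -natr1 => tn.
by rewrite /= in_itv/=; split; [apply/andP; split|]; lra.
Qed.

Lemma concatenationE n (t : R) : n%:R <= t < n%:R + 1 ->
  concatenation t = G n (t - n%:R).
Proof. by rewrite natr1 => /Num.Theory.truncn_def; rewrite /concatenation => ->. Qed.

Let Gn_le n s t : 0 <= s -> s <= t -> t <= 1 -> G n s `<=` G n t.
Proof.
move=> s0; rewrite le_eqVlt => /predU1P[->|st] t1; first by [].
have [||+ _] := G_inc n s t _ _ st; rewrite /= ?in_itv/=; [lra|lra|exact].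
Qed.

Lemma chain_le m n : (m <= n)%N -> G m 0 `<=` G n 0.
Proof.
elim: n => [|n IHn]; first by rewrite leqn0 => /eqP ->.
rewrite leq_eqVlt => /predU1P[->//|/IHn mn].
by apply: subset_trans mn _; rewrite -G_chain; apply: Gn_le.
Qed.

Lemma chain_concatenation n (t : R) : n%:R <= t -> G n 0 `<=` concatenation t.
Proof.
move=> nt; have t0 : 0 <= t by apply: le_trans nt.
have [/=+ _] := frac_itv _ t0; rewrite in_itv/= => /andP[u0 u1].
have nT : (n <= Num.truncn t)%N by rewrite truncn_ge_nat.
by apply: subset_trans (chain_le _ _ nT) _; apply: Gn_le.
Qed.

Lemma concatenation_increasing : hincreasing [set t | 0 <= t] concatenation.
Proof.
move=> s t s0 t0 st; have [mu mu1] := frac_itv _ s0; have [mv mv1] := frac_itv _ t0.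
have := le_truncn (ltW st); rewrite leq_eqVlt => /predU1P[nE|mn].
  rewrite /concatenation -nE; apply: G_inc => //; first by rewrite nE.
  by rewrite ltrD2r.
(* When the integer parts differ, strictness comes from the piece of [s], whose fractional part is
   below 1; the rest only needs inclusion. *)
have sub : G (Num.truncn s) 1 `<=` concatenation t.
  rewrite G_chain; apply: chain_concatenation.
  by rewrite -truncn_ge_nat.
have [sub' nsub] := G_inc (Num.truncn s) _ _ mu mem1 mu1.
split; first exact: subset_trans sub' sub.
by move=> ts; apply: nsub; exact: subset_trans sub ts.
Qed.

Lemma concatenation_continuous : (forall n, hcontinuous `[0, 1] (G n)) ->
  hcontinuous [set t | 0 <= t] concatenation.
Proof.
move=> Gc t t0 e e0; have [mt ft1] := frac_itv _ t0.
have [nt tn] := andP (Num.Theory.truncn_itv t0); rewrite -natr1 in tn.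
set n := Num.truncn t in mt ft1 nt tn.
have tE : concatenation t = G n (t - n%:R) by [].
clearbody n.
have [d1 d10 right_close] : exists2 d : R, 0 < d & forall s, n%:R <= s ->
    `|t - s| < d -> hclose e (concatenation t) (concatenation s).
  have [d d0 hd] := Gc n _ mt _ e0.
  exists (Num.min d (n%:R + 1 - t)); first by rewrite lt_min d0/=; lra.
  move=> s ns; rewrite lt_min => /andP[tsd tsn].
  have sn : s < n%:R + 1 by move: tsn; rewrite ltr_norml; lra.
  rewrite tE (concatenationE n) ?ns//; apply: hd.
    by rewrite /= in_itv/=; apply/andP; split; lra.
  by rewrite [_ - _](_ : _ = t - s)//; lra.
(* Off the integers, radius [t - n%:R] leaves no such [s], and at 0 there is none. At [m.+1],
   continuity of piece [m] at its end 1 applies, radius at most 1 keeping [s] in that piece. *)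
have [d2 d20 left_close] : exists2 d : R, 0 < d & forall s, 0 <= s -> s < n%:R ->
    `|t - s| < d -> hclose e (concatenation t) (concatenation s).
  have [ntE|tn0] := eqVneq (n%:R) t; last first.
    exists (t - n%:R); first by rewrite subr_gt0 lt_neqAle tn0.
    by move=> s s0 sn; rewrite ltr_norml; lra.
  clear mt ft1 right_close; move: n nt tn tE ntE => [|m] nt tn tE ntE.
    by exists 1 => // s s0 sn; lra.
  have [d d0 hd] := Gc m _ mem1 _ e0.
  exists (Num.min d 1); first by rewrite lt_min d0/=.
  move=> s s0 sn; rewrite lt_min => /andP[tsd ts1].
  rewrite -natr1 in sn ntE.
  have ms : m%:R <= s by move: ts1; rewrite ltr_norml; lra.
  rewrite tE (concatenationE m) ?ms// -[m.+1%:R]natr1 ntE subrr -G_chain.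
  apply: hd; first by rewrite /= in_itv/=; apply/andP; split; lra.
  by rewrite [_ - _](_ : _ = t - s)//; lra.
exists (Num.min d1 d2); first by rewrite lt_min d10.
move=> s s0; rewrite lt_min => /andP[ts1 ts2].
by have [ns|sn] := leP n%:R s; [exact: right_close|exact: left_close].
Qed.

End Concatenation.

(** * Exhaustion of the space and the final order arc *)

(** Near each point some [U m] is met by [K m.+1], hence by all later stages. Compactness turns
    these local indices into one; halving [e] leaves room to move the point. *)
Lemma chain_exhausts (K U : nat -> set X) : compact [set: X] ->
  (forall m n, (m <= n)%N -> K m `<=` K n) ->
  (forall n, K n.+1 `&` U n !=set0) ->
  (forall y e, 0 < e -> exists n, U n `<=` ball y e) ->
  forall e, 0 < e -> exists n, [set: X] `<=` nbhd e (K n).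
Proof.
move=> /compact_near_coveringP cX Kmono KU Ub e e0.
have [y _|N _ hN] := cX nat \oo (fun n => nbhd e (K n)) _ _; last first.
  by exists N; exact: (hN N (leqnn N)).
have e20 : 0 < e / 2 by rewrite divr_gt0.
have [m Um] := Ub y _ e20; have [a [Ka /Um ya]] := KU m.
exists (ball y (e / 2), [set n | (m < n)%N]).
  by split; [exact: nbhsx_ballx|exists m.+1].
move=> [z n] [/= yz mn]; exists a; first exact: Kmono mn _ Ka.
by rewrite (splitr e); apply: (@ball_triangle _ _ y) => //; exact: ball_sym.
Qed.

(* [t |-> (1 - t)^-1 - 1] maps [0, 1[ increasingly onto [0, +oo[. *)
Lemma order_arc_completion P : compact [set: X] ->
  hcontinuous [set t | 0 <= t] P -> hincreasing [set t | 0 <= t] P ->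
  (forall t, 0 <= t -> closed_hyperspace (P t)) ->
  (forall e, 0 < e -> exists n : nat,
     forall t, n%:R <= t -> [set: X] `<=` nbhd e (P t)) ->
  order_arc (fun t => if t < 1 then P ((1 - t)^-1 - 1) else [set: X]).
Proof.
move=> cX Pc Pi Pcl Pe.
have T0 (t : R) : 0 <= t -> t < 1 -> 0 <= (1 - t)^-1 - 1.
  by move=> t0 t1; rewrite subr_ge0 invf_ge1; lra.
have Ti (s t : R) : s < t -> t < 1 -> (1 - s)^-1 - 1 < (1 - t)^-1 - 1.
  by move=> st t1; rewrite ltrD2r ltf_pV2 ?posrE; lra.
split.
- move=> t; rewrite in_itv/= => /andP[t0 _]; case: ifPn => t1.
    by apply: Pcl; exact: T0.
  have [[x Px] _] := Pcl 0 (lexx _).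
  by split; [exists x|exact: closedT].
- move=> t; rewrite in_itv/= => /andP[t0 t1] e e0.
  have e20 : 0 < e / 2 by rewrite divr_gt0.
  (* [hausdorff_dist_le] yields only a weak inequality, whence [e / 2]. *)
  suff [d d0 hd] : exists2 d : R, 0 < d & forall s, 0 <= s <= 1 ->
      `|t - s| < d -> hclose (e / 2)
        (if t < 1 then P ((1 - t)^-1 - 1) else [set: X])
        (if s < 1 then P ((1 - s)^-1 - 1) else [set: X]).
    apply/nbhs_ballP; exists d => //= s ts s01.
    have {}s01 : 0 <= s <= 1 by move: s01; rewrite in_itv.
    have := hausdorff_dist_le _ _ _ e20 (hd s s01 ts).
    by move=> /le_lt_trans; apply; lra.
  have [tlt1|tge1] := ltP t 1; last first.
    (* If [1 - s] is below this radius, then [(1 - s)^-1 - 1] is at least [n]. *)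
    have [n hn] := Pe _ e20; exists (n.+1%:R)^-1; first by rewrite invr_gt0.
    move=> s /andP[s0 s1] ts; case: ifPn => [slt1|_]; last exact: hclose_refl.
    apply: hcloseC; apply: hclose_sub => //; apply: hn.
    have {t1 tge1}tE : t = 1 by apply/le_anti/andP.
    move: ts; rewrite tE gtr0_norm ?subr_gt0// => ts.
    rewrite lerBrDr natr1 -[n.+1%:R]invrK lef_pV2 ?posrE ?invr_gt0 ?subr_gt0//.
    exact: ltW.
  have [d d0 hd] := Pc _ (T0 _ t0 tlt1) _ e20.
  have Tc : {for t, continuous (fun s : R => (1 - s)^-1 - 1)}.
    apply: (@continuousB _ R^o) => //; last exact: cvg_cst.
    apply: continuousV; first by rewrite gt_eqF// subr_gt0.
    by apply: (@continuousB _ R^o) => //; exact: cvg_cst.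
  have /nbhs_ballP[d' /= d'0 hd'] := Tc _ (nbhsx_ballx _ _ d0).
  exists (Num.min d' (1 - t)); first by rewrite lt_min d'0 subr_gt0.
  move=> s /andP[s0 _]; rewrite lt_min => /andP[/hd' /= Tst sn].
  have s1 : s < 1 by move: sn; rewrite ltr_norml; lra.
  by rewrite s1; apply: hd => //=; exact: T0.
- move=> s t s0 st t1; have s1 : s < 1 by exact: lt_le_trans st t1.
  rewrite s1; case: ifPn => tlt1.
    by apply: Pi; [exact: T0|apply: T0 => //; exact: ltW (le_lt_trans s0 st)|exact: Ti].
  have u0 := T0 s s0 s1.
  (* No value of [P] is all of [X], since [P] is strictly larger one unit later. *)
  have [_ nP] := Pi _ (1 + ((1 - s)^-1 - 1)) u0
    ltac:(rewrite /=; lra) ltac:(lra).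
  by split=> // TP; apply: nP; exact: subset_trans TP.
Qed.

Lemma nonblocker_of_arc_connectedC A : continuum X ->
  closed_hyperspace A -> interior A = set0 -> arc_connected (~` A) ->
  nonblocker A.
Proof.
move=> [_ cX ctX] clA A0 acA; have [An0 _] := clA.
have AT : A <> setT.
  by move=> AT; case: An0 => a Aa; have : interior A a; [rewrite AT interiorT|rewrite A0].
split=> // x Ax.
have [U [oU U0 Ub]] := compact_countable_pibase x cX.
(* Choosing a growth for every pair, with a dummy value when [growth] fails, lets the stages be
   defined by recursion before the invariant is proved. *)
have /choice[S hS] : forall nK : nat * set X, exists G : R -> set X,
    growth A x nK.2 ->
    [/\ G 0 = nK.2, G 1 `&` U nK.1 !=set0,
      forall u, `[0, 1]%classic u -> growth A x (G u),
      hcontinuous `[0, 1] G & hincreasing `[0, 1] G].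
  move=> [n K]; have [gK|ngK] := pselect (growth A x K); last by exists (fun=> set0).
  by have [G hG] := growth_step A x K (U n) An0 A0 acA gK (oU n) (U0 n); exists G.
pose K := fix K n := if n is m.+1 then S (m, K m) 1 else [set x].
have mem1 : `[0, 1]%classic (1 : R) by rewrite /= in_itv/= lexx ler01.
have gK n : growth A x (K n).
  elim: n => [|n IHn]; last by have [_ _ /(_ _ mem1)] := hS (n, K n) IHn.
  split=> //; last by apply/seteqP; split=> // z [/= ->].
  by split; [exists x|exact: compact_set1|exact: connected1].
pose G n := S (n, K n).
have G0 n : G n 0 = K n by have [] := hS (n, K n) (gK n).
have GU n : G n 1 `&` U n !=set0 by have [] := hS (n, K n) (gK n).
have gG n u : `[0, 1]%classic u -> growth A x (G n u).
  by have [_ _ + _ _] := hS (n, K n) (gK n); exact.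
have Gc n : hcontinuous `[0, 1] (G n) by have [] := hS (n, K n) (gK n).
have Gi n : hincreasing `[0, 1] (G n) by have [] := hS (n, K n) (gK n).
have Gchain n : G n 1 = G n.+1 0 by rewrite G0.
pose P := concatenation G.
have gP t : 0 <= t -> growth A x (P t) by move=> /frac_itv[mt _]; exact: gG.
have T0 (t : R) : 0 <= t -> t < 1 -> 0 <= (1 - t)^-1 - 1.
  by move=> t0 t1; rewrite subr_ge0 invf_ge1; lra.
exists (fun t => if t < 1 then P ((1 - t)^-1 - 1) else [set: X]); split.
- apply: order_arc_completion => //.
  + exact: concatenation_continuous.
  + exact: concatenation_increasing.
  + by move=> t /gP[/subcontinuum_hyperspace[]].
  + move=> e e0.
    have [||n hn] := chain_exhausts (fun n => G n 0) U cX _ _ Ub _ e0.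
    * by move=> m n; exact: chain_le.
    * by move=> n; rewrite -Gchain.
    exists n => t nt; apply: subset_trans hn _; apply: nbhd_sub => //.
    exact: chain_concatenation.
- move=> t; rewrite in_itv/= => /andP[t0 t1]; case: ifPn => tlt1.
    by have [/subcontinuum_hyperspace] := gP _ (T0 _ t0 tlt1).
  by split=> //; split; [exists x|exact: closedT].
- by rewrite ltr01 subr0 invr1 subrr /P /concatenation truncn0 subrr G0.
- by rewrite ltxx.
- move=> t; rewrite in_itv/= => /andP[t0 t1]; rewrite t1.
  by have [] := gP _ (T0 _ t0 t1).
Qed.

End Continua.

Theorem theorem4p2 (R : realType) (X : metricType R) (dendX : dendroid X)
  (nshore : exists p : X, ~ shore_set [set p])
  (A : set X) (CA : connected_hyperspace A) :
  connected_nonblockers A <-> interior A = set0 /\ arc_connected (~` A).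
Proof.
have [ctmX _ _] := dendX; have [_ cX _] := ctmX; have [clA ctA] := CA.
split=> [[nbA _]|[A0 acA]].
  by split; [exact: nonblocker_interior0|exact: nonblocker_arc_connectedC].
by split=> //; exact: nonblocker_of_arc_connectedC.
Qed.
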